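(* Let $A$ be a monoid and $M$ an $A$-set. Then the set $SSet(M|A)$ of all $A$-subsets of $M$, with the hull-kernel topology, is a spectral space. Moreover, the collection of sets $\mathbb{S}:=\{D(x_1,\ldots,x_n)\mid x_1,\ldots,x_n\in M\}$, where $D(x_1,\ldots,x_n):=\{N\in SSet(M|A)\mid \{x_1,\ldots,x_n\}\nsubseteq N\}$, is a subbasis of quasi-compact open subspaces of $SSet(M|A)$.
   Context: A monoid means a commutative monoid, written multiplicatively, with identity $1$ and a base point $0$ satisfying $0\cdot a=0$ for all $a$. An $A$-set is a pointed set $(M,0_M)$ with an action $A\times M\to M$ satisfying $1\cdot x=x$, $0_A\cdot x=0_M$, $a\cdot 0_M=0_M$ and $(ab)\cdot x=a\cdot(b\cdot x)$. An $A$-subset of $M$ is a (pointed, i.e. containing $0_M$) subset $N\subseteq M$ with $ay\in N$ for all $a\in A$, $y\in N$. For a set $S$, the hull-kernel topology on the power set $2^S$ is the topology with open subbasis the sets $\{R\subseteq S\mid F\nsubseteq R\}$, $F\subseteq S$ finite; the hull-kernel topology on $SSet(M|A)$ is the subspace topology induced from $2^M$. A topological space is spectral if it is homeomorphic to the prime spectrum of a commutative ring with the Zariski topology; equivalently it is $T_0$, quasi-compact, has a basis of quasi-compact open subspaces closed under finite intersections, and every irreducible closed subspace has a unique generic point. *)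

(* Defs.v *)
From HB Require Import structures.
From mathcomp Require Import all_boot all_algebra.
From mathcomp Require Import all_classical topology.

Set Implicit Arguments.
Unset Strict Implicit.
Unset Printing Implicit Defensive.

Local Open Scope classical_set_scope.

(* The equation [mul0g] is the only axiom on 0; the case 0 = 1 is allowed. *)
HB.mixin Record Monoid_isPointedComm A of monoid.Monoid A := {
  zerog : A;
  mulgC : forall a b : A, (a * b)%g = (b * a)%g;
  mul0g : forall a : A, (zerog * a)%g = zerog
}.

#[short(type="pmonoidType")]
HB.structure Definition PMonoid := {A of Monoid_isPointedComm A & monoid.Monoid A}.

(* The base point 0_M of an A-set M is [point]. *)
HB.mixin Record Pointed_isASet (A : pmonoidType) M of Pointed M := {
  act : A -> M -> M;
  act1 : forall x : M, act 1%g x = x;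
  act0 : forall x : M, act zerog x = point;
  act_point : forall a : A, act a point = point;
  actM : forall (a b : A) (x : M), act (a * b)%g x = act a (act b x)
}.

#[short(type="asetType")]
HB.structure Definition ASet (A : pmonoidType) :=
  {M of Pointed_isASet A M & Pointed M}.

Definition is_asubset (A : pmonoidType) (M : asetType A) (N : set M) : Prop :=
  N point /\ forall (a : A) (y : M), N y -> N (act a y).

Definition hull_kernel (S : Type) : Type := set S.

HB.instance Definition _ (S : Type) := Pointed.copy (hull_kernel S) (set S).

HB.instance Definition _ (S : Type) :=
  isSubBaseTopological.Build (hull_kernel S)
    (finite_set : set (set S))
    (fun F : set S => [set R : hull_kernel S | ~ (F `<=` R)]).

(* As a type, [SSet M] carries the library's subspace topology on subtypes. *)
Definition SSet (A : pmonoidType) (M : asetType A) : set (hull_kernel M) :=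
  [set N | is_asubset N].
Arguments SSet {A} M.

Definition DSSet (A : pmonoidType) (M : asetType A) (xs : seq M) :
  set (SSet M) := [set N | ~ ([set` xs] `<=` (val N : set M))].

Definition subbasis (T : topologicalType) (B : set_system T) : Prop :=
  basis (finI_from B id).

Definition homeomorphic (X Y : topologicalType) : Prop :=
  exists (f : X -> Y) (g : Y -> X),
    [/\ cancel f g, cancel g f, continuous f & continuous g].

(* The library's [prime_idealr] only covers nonzero rings; the zero ring, whose
   spectrum is empty, is included here. *)
Record prime_ideal (R : comPzRingType) (P : set R) : Prop := PrimeIdeal {
  prime_ideal0 : P 0%R;
  prime_idealD : forall a b : R, P a -> P b -> P (a + b)%R;
  prime_idealMl : forall a b : R, P b -> P (a * b)%R;
  prime_ideal1 : ~ P 1%R;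
  prime_idealM : forall a b : R, P (a * b)%R -> P a \/ P b
}.

Definition Spec (R : comPzRingType) : Type := {P : set R | prime_ideal P}.

HB.instance Definition _ (R : comPzRingType) := gen_eqMixin (Spec R).
HB.instance Definition _ (R : comPzRingType) := gen_choiceMixin (Spec R).

Section Zariski.
Variable R : comPzRingType.

Definition Vset (E : set R) : set (Spec R) := [set P | E `<=` sval P].

Definition zariski_open (U : set (Spec R)) : Prop :=
  exists E : set R, U = ~` Vset E.

Let zariski_openT : zariski_open setT.
Proof.
exists setT; apply/seteqP; split=> // P _ PT.
exact: (prime_ideal1 (svalP P)) (PT _ I).
Qed.

Let zariski_openI : setI_closed zariski_open.
Proof.
move=> _ _ [E ->] [F ->]; exists [set (a * b)%R | a in E & b in F].
apply/seteqP; split=> P /=.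
  move=> [nE nF] EF; apply: nE => a Ea; apply: contrapT => nPa.
  apply: nF => b Fb; have abP : sval P (a * b)%R.
    by apply: EF; exists a => //; exists b.
  by have [/nPa|] := prime_idealM (svalP P) abP.
move=> nEF; split=> sub; apply: nEF => _ [a Ea [b Fb <-]].
  by rewrite GRing.mulrC; apply: (prime_idealMl (svalP P)); apply: sub.
by apply: (prime_idealMl (svalP P)); apply: sub.
Qed.

Let zariski_open_bigU (I : Type) (f : I -> set (Spec R)) :
  (forall i, zariski_open (f i)) -> zariski_open (\bigcup_i f i).
Proof.
move=> /choice[E fE]; exists (\bigcup_i E i).
apply/seteqP; split=> P /=.
  by move=> [i _]; rewrite fE => nE sub; apply: nE => a Ea; apply: sub; exists i.
move=> nE; apply: contrapT => nf; apply: nE => a [i _ Ea].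
have : Vset (E i) P by apply: contrapT => nV; apply: nf; exists i; rewrite ?fE.
exact.
Qed.

HB.instance Definition _ :=
  isOpenTopological.Build (Spec R) zariski_openT zariski_openI zariski_open_bigU.

End Zariski.

Definition spectral (X : topologicalType) : Prop :=
  exists R : comPzRingType, homeomorphic X (Spec R).

(* Main.v *)
Require Import Defs.
From HB Require Import structures.
From mathcomp Require Import all_boot all_algebra.
From mathcomp Require Import all_classical topology.

(** Identify [N] with a point of the power set of [M].  The two conditions that
    define an [A]-subset involve at most two elements of [M] at a time, so
    [SSet M] is closed in the product (patch) topology of the power set, and the
    theorem is an instance of [patch_closed_spectral]: every patch-closed family
    [X] of subsets of [M] is spectral in the hull-kernel topology.

    The ring with spectrum [X] consists of functions on [X].  Let [K] be the
    field of rational functions in indeterminates [t_x], one for each [x] of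
    [M].  For a subset [S] of [M], scale the [t_x] with [x] in [S] by a parameter
    [u] and let [u] tend to [0]; write [has_limit S a b] when [a] tends to [b].
    For fixed [S], the elements with a limit form a local subring of [K], whose
    maximal ideal consists of those with limit [0]; the order of vanishing in [u]
    is an integer-valued valuation.  The ring [R] is made of the functions
    [f : X -> K] which depend on finitely many memberships only and satisfy
    [has_limit N' (f N) (f N')] whenever [N] is contained in [N'].  The function
    [coordinate x] with value [t_x] on the [N] that avoid [x], and [0] elsewhere,
    belongs to [R].  Each [N] gives the prime ideal [zero_ideal N] of the [f]
    with [f N = 0], and the coordinates show that this is injective.

    Three facts make it a homeomorphism.
    - If [g] vanishes wherever [f] does, then [f] divides a power of [g]
      ([zero_locus_subset]): the quotient [g ^ n / f] again lies in [R], because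
      a high power of an element of limit [0] beats any given denominator, with
      an exponent that does not depend on [S] ([has_limit_expf_div]).
    - The common zeros of [f] and [g] are the zeros of [f + n g] for some natural
      number [n] ([zero_locus_add]): such functions have finite range and [K]
      has characteristic zero.
    - [X] is compact in the patch topology ([patch_compact]).  Given a prime
      ideal [P] of [R], the first two facts say that the sets where a given
      member of [P] vanishes and a given non-member does not form a filter
      basis; the limit of a finer ultrafilter is a point [N] with
      [zero_ideal N = P].  Compactness also shows that the set where a member of
      [R] is nonzero is open ([open_nonzero]).

    Patch compactness gives the compactness of the sets [DSSet xs] as well. *)

Set Implicit Arguments.
Unset Strict Implicit.
Unset Printing Implicit Defensive.

Local Open Scope classical_set_scope.

Import GRing.Theory Num.Theory.

(** * Polynomial expressions *)

Section Expressions.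
Local Open Scope ring_scope.
Variable I : Type.

(** Polynomials are kept as syntax so that one and the same expression can be
    evaluated at the indeterminates and at their scaled versions. *)
Inductive pexpr :=
  | PVar of I
  | POne
  | PSub of pexpr & pexpr
  | PMul of pexpr & pexpr.

Fixpoint peval (E : pzRingType) (t : I -> E) (e : pexpr) : E :=
  match e with
  | PVar x => t x
  | POne => 1
  | PSub e1 e2 => peval t e1 - peval t e2
  | PMul e1 e2 => peval t e1 * peval t e2
  end.

Definition PPow (e : pexpr) (n : nat) : pexpr := iter n (PMul e) POne.

Lemma peval_pow (E : pzRingType) (t : I -> E) e n :
  peval t (PPow e n) = peval t e ^+ n.
Proof. by elim: n => [|n IH] //=; rewrite IH exprS. Qed.

Lemma rmorph_peval (E E' : pzRingType) (h : {rmorphism E -> E'}) (t : I -> E) e :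
  h (peval t e) = peval (fun x => h (t x)) e.
Proof.
elim: e => //= [|e1 IH1 e2 IH2|e1 IH1 e2 IH2]; first exact: rmorph1.
  by rewrite rmorphB IH1 IH2.
by rewrite rmorphM IH1 IH2.
Qed.

Lemma eq_peval (E : pzRingType) (t t' : I -> E) e :
  t =1 t' -> peval t e = peval t' e.
Proof. by move=> tt'; elim: e => //= e1 -> e2 ->. Qed.

End Expressions.
Arguments POne {I}.

Lemma int_poly_eq0 (p : {poly int}) : (forall u : int, p.[u] = 0)%R -> p = 0%R.
Proof.
move=> p0; apply/eqP; apply: contraT => nz.
have := @max_poly_roots _ p [seq i%:Z%R | i <- iota 0 (size p)] nz.
rewrite size_map size_iota ltnn; apply.
  by apply/allP => _ /mapP[i _ ->]; apply/eqP/p0.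
by rewrite map_inj_uniq ?iota_uniq // => i j [].
Qed.

(** * Integer polynomials in arbitrarily many variables *)

Section IntegerPolynomials.
Local Open Scope ring_scope.
Variable I : Type.

Definition polyfun : {pred (I -> int) -> int} :=
  fun f => `[< exists e, f = fun s => peval s e >].

Lemma polyfun_subring : subring_closed polyfun.
Proof.
split.
- by apply/asboolP; exists POne.
- move=> _ _ /asboolP[e ->] /asboolP[d ->]; apply/asboolP.
  by exists (PSub e d).
- move=> _ _ /asboolP[e ->] /asboolP[d ->]; apply/asboolP.
  by exists (PMul e d).
Qed.

(** Since the integers are infinite, an integer polynomial is determined by its
    values: the polynomial ring is realised as a ring of functions. *)
Record zpoly := ZPoly { zpoly_fun :> (I -> int) -> int; _ : zpoly_fun \in polyfun }.

HB.instance Definition _ := [isSub for zpoly_fun].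
HB.instance Definition _ := [Choice of zpoly by <:].
HB.instance Definition _ :=
  GRing.SubChoice_isSubComPzRing.Build _ _ zpoly polyfun_subring.

Lemma zpoly_ext (p q : zpoly) : (forall s, p s = q s) -> p = q.
Proof. by move=> pq; apply: val_inj; apply: funext. Qed.

Definition zvar (x : I) : zpoly :=
  @ZPoly (fun s => s x) (asboolT (ex_intro _ (PVar x) erefl)).

Definition zpoly_eval (s : I -> int) (p : zpoly) : int := p s.

Lemma zpoly_eval_is_zmod_morphism s : zmod_morphism (zpoly_eval s).
Proof. by []. Qed.

Lemma zpoly_eval_is_monoid_morphism s : monoid_morphism (zpoly_eval s).
Proof. by []. Qed.

HB.instance Definition _ s := GRing.isZmodMorphism.Build zpoly int (zpoly_eval s)
  (zpoly_eval_is_zmod_morphism s).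
HB.instance Definition _ s := GRing.isMonoidMorphism.Build zpoly int (zpoly_eval s)
  (zpoly_eval_is_monoid_morphism s).

Lemma zpoly_nontrivial : (1 : zpoly) != 0.
Proof. by apply/eqP => /(congr1 (zpoly_eval (fun=> 0))). Qed.

HB.instance Definition _ := GRing.PzSemiRing_isNonZero.Build zpoly zpoly_nontrivial.

Lemma zpolyP (p : zpoly) : exists e, p = peval zvar e.
Proof.
have /asboolP[e pe] := valP p; exists e; apply: zpoly_ext => s.
rewrite -[RHS]/(zpoly_eval s _) rmorph_peval.
exact: (congr1 (@^~ s) pe).
Qed.

(** Restricting to the line through a point where [p] is nonzero and a point
    where [q] is nonzero reduces the claim to polynomials in one variable. *)
Lemma zpoly_mulf_eq0 (p q : zpoly) : p * q = 0 -> (p == 0) || (q == 0).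
Proof.
move=> pq0; apply: contraT; rewrite negb_or => /andP[p0 q0]; exfalso.
have nz (r : zpoly) : r != 0 -> exists s, r s <> 0.
  move=> r0; apply: contrapT => rs; case/eqP: r0; apply: zpoly_ext => s.
  by apply: contrapT => rs0; apply: rs; exists s.
have [s ps] := nz _ p0; have [s' qs'] := nz _ q0.
have [e pe] := zpolyP p; have [d qd] := zpolyP q.
pose line x : {poly int} := (s x)%:P + (s' x - s x) *: 'X.
pose at_ (u : int) x := (line x).[u].
have restr (r : zpoly) c : r = peval zvar c -> forall u, (peval line c).[u] = r (at_ u).
  move=> -> u; rewrite -[LHS]/(horner_eval u _) -[RHS]/(zpoly_eval _ _) !rmorph_peval.
  exact: eq_peval.
have : peval line e * peval line d = 0.
  apply: int_poly_eq0 => u; rewrite hornerM (restr _ _ pe) (restr _ _ qd).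
  exact: (congr1 (zpoly_eval (at_ u)) pq0).
move/eqP; rewrite mulf_eq0 => /orP[]/eqP z0.
  apply: ps; have := restr _ _ pe 0; rewrite z0 horner0 => /esym.
  suff -> : at_ 0 = s by [].
  by apply: funext => x; rewrite /at_ !hornerE.
apply: qs'; have := restr _ _ qd 1; rewrite z0 horner0 => /esym.
suff -> : at_ 1 = s' by [].
by apply: funext => x; rewrite /at_ /line !hornerE /= addrAC subrr add0r.
Qed.

Definition zpoly_unit : {pred zpoly} := fun p => `[< exists q, q * p = 1 >].
Definition zpoly_inv (p : zpoly) : zpoly := xget p [set q | q * p = 1].

Lemma zpoly_mulVr : {in zpoly_unit, left_inverse 1 zpoly_inv *%R}.
Proof.
by move=> p /asboolP[q qp]; rewrite /zpoly_inv; case: xgetP => [? -> //|/(_ q)].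
Qed.

Lemma zpoly_unitPl (p q : zpoly) : q * p = 1 -> zpoly_unit p.
Proof. by move=> qp; apply/asboolP; exists q. Qed.

Lemma zpoly_invr_out : {in [predC zpoly_unit], zpoly_inv =1 id}.
Proof.
move=> p /asboolPn nq; rewrite /zpoly_inv; case: xgetP => // q _ qp.
by case: nq; exists q.
Qed.

HB.instance Definition _ := GRing.ComNzRing_hasMulInverse.Build zpoly
  zpoly_mulVr zpoly_unitPl zpoly_invr_out.
HB.instance Definition _ := GRing.ComUnitRing_isIntegral.Build zpoly zpoly_mulf_eq0.

End IntegerPolynomials.

(** * A field with independent elements *)

Section Generic.
Local Open Scope ring_scope.

Definition scaled (I : Type) (E : nzRingType) (S : set I) (t : I -> E) (x : I) :
    {poly E} :=
  (t x)%:P * 'X ^+ `[< S x >].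

(** The last axiom is algebraic independence of the family in the form needed
    here: the scaling substitution is well defined on the subring it generates.
    The axioms are bundled so that the sequel never unfolds the construction of
    the field. *)
Record generic_family (I : Type) := GenericFamily {
  gfield : fieldType;
  gvar : I -> gfield;
  gvar_neq0 : forall x, gvar x != 0;
  gfield_natr_inj : injective (fun n => n%:R : gfield);
  gscaled_eq0 : forall (S : set I) e,
    peval gvar e = 0 -> peval (scaled S gvar) e = 0
}.

Variable I : Type.

Local Notation K := {fraction zpoly I}.
Local Notation kvar := (fun x : I => FracField.tofrac (zvar x)).

Lemma tofrac_peval (e : pexpr I) :
  FracField.tofrac (peval (@zvar I) e) = peval kvar e.
Proof. exact: rmorph_peval. Qed.

Lemma kvar_neq0 x : kvar x != 0.
Proof.
rewrite tofrac_eq0; apply/eqP => /(congr1 (fun p : zpoly I => p (fun=> 1))).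
by [].
Qed.

Lemma frac_zpoly_natr_inj : injective (fun n => n%:R : K).
Proof.
have nat_tofrac n : n%:R = FracField.tofrac (n%:R : zpoly I) by rewrite rmorph_nat.
move=> m n /eqP; rewrite !nat_tofrac tofrac_eq => /eqP.
move=> /(congr1 (zpoly_eval (fun=> 0))); rewrite !rmorph_nat.
by move/eqP; rewrite eqr_nat => /eqP.
Qed.

(** At an integer point [s] and an integer value [u] of the parameter, the scaled
    expression is the original one at the point obtained from [s] by multiplying
    the coordinates in [S] by [u], where it vanishes. *)
Lemma kvar_scaled_eq0 (S : set I) (e : pexpr I) :
  peval kvar e = 0 -> peval (scaled S kvar) e = 0.
Proof.
rewrite -tofrac_peval => /eqP; rewrite tofrac_eq0 => /eqP e0.
suff se0 : peval (scaled S (@zvar I)) e = 0.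
  rewrite -(rmorph0 (map_poly (@FracField.tofrac (zpoly I)))) -se0 rmorph_peval.
  apply: eq_peval => x.
  by rewrite /scaled rmorphM rmorphXn /= map_polyC map_polyX.
apply/polyP => i; rewrite coef0; apply: zpoly_ext => s.
rewrite -[LHS]/(zpoly_eval s _) -coef_map.
suff -> : map_poly (zpoly_eval s) (peval (scaled S (@zvar I)) e) = 0 by rewrite coef0.
apply: int_poly_eq0 => u.
rewrite -[LHS]/(horner_eval u _) !rmorph_peval.
set s' := fun x => _; suff -> : peval s' e = zpoly_eval s' (peval (@zvar I) e).
  by rewrite e0.
by rewrite rmorph_peval.
Qed.

Definition zpoly_family : generic_family I :=
  GenericFamily kvar_neq0 frac_zpoly_natr_inj kvar_scaled_eq0.

End Generic.

(** * Limits along a scaling *)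

Section Limits.
Local Open Scope ring_scope.
Variables (I : Type) (T : generic_family I).
Local Notation K := (gfield T).
Local Notation kvar := (gvar T).
Section FixedSet.
Variable S : set I.

(** The fraction [a] is [e / d]; after the substitution both terms may vanish at
    [u = 0], and the limit is read off once a common power of [u] is removed. *)
Variant has_limit (a b : K) : Prop :=
  HasLimit (e d : pexpr I) (k : nat) (P Q : {poly K}) of
    a = peval kvar e / peval kvar d &
    peval (scaled S kvar) e = 'X ^+ k * P &
    peval (scaled S kvar) d = 'X ^+ k * Q &
    Q.[0] != 0 & b = P.[0] / Q.[0].

Lemma horner0_neq0 (P : {poly K}) : P.[0] != 0 -> P != 0.
Proof. by apply: contra => /eqP ->; rewrite horner0. Qed.

Lemma scaled_peval_neq0 (e : pexpr I) k (P : {poly K}) :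
  peval (scaled S kvar) e = 'X ^+ k * P -> P.[0] != 0 -> peval kvar e != 0.
Proof.
move=> eP /horner0_neq0 P0; apply/eqP => /(gscaled_eq0 S) /eqP.
by rewrite eP mulf_eq0 expf_eq0 polyX_eq0 andbF (negbTE P0).
Qed.

Lemma has_limit0 : has_limit 0 0.
Proof.
apply: (@HasLimit _ _ (PSub POne POne) POne 0 0 1).
- by rewrite /= subrr mul0r.
- by rewrite /= subrr mulr0.
- by rewrite /= mulr1.
- by rewrite hornerC oner_neq0.
- by rewrite horner0 mul0r.
Qed.

Lemma has_limit1 : has_limit 1 1.
Proof.
apply: (@HasLimit _ _ POne POne 0 1 1); rewrite ?divff ?oner_neq0 //=;
  by rewrite ?mulr1 ?hornerC ?divff ?oner_neq0.
Qed.

Lemma has_limitB a b a' b' :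
  has_limit a b -> has_limit a' b' -> has_limit (a - a') (b - b').
Proof.
case=> e d k P Q -> eP dQ Q0 ->; case=> e' d' k' P' Q' -> eP' dQ' Q0' ->.
have d0 := scaled_peval_neq0 dQ Q0; have d0' := scaled_peval_neq0 dQ' Q0'.
apply: (@HasLimit _ _ (PSub (PMul e d') (PMul e' d)) (PMul d d') (k + k')
          (P * Q' - P' * Q) (Q * Q')).
- by rewrite /= -[in LHS]mulNr addf_div // mulNr.
- by rewrite /= eP eP' dQ dQ' exprD mulrACA (mulrACA 'X^k') ['X^k' * _]mulrC -mulrBr.
- by rewrite /= dQ dQ' exprD mulrACA.
- by rewrite hornerM mulf_neq0.
- by rewrite hornerD hornerN !hornerM -[in LHS]mulNr addf_div // mulNr.
Qed.

Lemma has_limitM a b a' b' :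
  has_limit a b -> has_limit a' b' -> has_limit (a * a') (b * b').
Proof.
case=> e d k P Q -> eP dQ Q0 ->; case=> e' d' k' P' Q' -> eP' dQ' Q0' ->.
apply: (@HasLimit _ _ (PMul e e') (PMul d d') (k + k') (P * P') (Q * Q')).
- by rewrite /= mulf_div.
- by rewrite /= eP eP' exprD mulrACA.
- by rewrite /= dQ dQ' exprD mulrACA.
- by rewrite hornerM mulf_neq0.
- by rewrite !hornerM mulf_div.
Qed.

Lemma has_limitX a b n : has_limit a b -> has_limit (a ^+ n) (b ^+ n).
Proof.
move=> ab; elim: n => [|n IH]; first exact: has_limit1.
by rewrite !exprS; apply: has_limitM.
Qed.

Lemma has_limitV a b : has_limit a b -> b != 0 -> has_limit a^-1 b^-1.
Proof.
case=> e d k P Q -> eP dQ Q0 ->; rewrite mulf_eq0 invr_eq0 negb_or => /andP[P0 _].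
by apply: (@HasLimit _ _ d e k Q P); rewrite ?invf_div.
Qed.

Lemma has_limit_neq0 a b : has_limit a b -> b != 0 -> a != 0.
Proof.
case=> e d k P Q -> eP dQ Q0 ->; rewrite mulf_eq0 invr_eq0 negb_or => /andP[P0 _].
rewrite mulf_neq0 ?invr_eq0 //; first exact: scaled_peval_neq0 eP P0.
exact: scaled_peval_neq0 dQ Q0.
Qed.

Lemma has_limit_var_in x : S x -> has_limit (kvar x) 0.
Proof.
move=> Sx; apply: (@HasLimit _ _ (PVar x) POne 0 (scaled S kvar x) 1).
- by rewrite /= divr1.
- by rewrite mul1r.
- by rewrite /= mulr1.
- by rewrite hornerC oner_neq0.
- by rewrite /scaled asboolT // expr1 hornerM hornerX mulr0 mul0r.
Qed.

Lemma has_limit_var_notin x : ~ S x -> has_limit (kvar x) (kvar x).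
Proof.
move=> Sx; apply: (@HasLimit _ _ (PVar x) POne 0 (scaled S kvar x) 1).
- by rewrite /= divr1.
- by rewrite mul1r.
- by rewrite /= mulr1.
- by rewrite hornerC oner_neq0.
- by rewrite /scaled asboolF // expr0 mulr1 !hornerC divr1.
Qed.

End FixedSet.

(** Substituting [t_x] or [t_x u] for each indeterminate gives a degree in [u]
    which is bounded whatever the set [S]. *)
Lemma scaled_peval_size (e : pexpr I) :
  exists n, forall S : set I, (size (peval (scaled S kvar) e) <= n)%N.
Proof.
elim: e => [x||e [n IHe] d [m IHd]|e [n IHe] d [m IHd]] /=.
- exists 2%N => S; rewrite /scaled.
  apply: leq_trans (size_polyMleq _ _) _.
  rewrite size_polyXn size_polyC addnS /=.
  by case: (_ != 0); case: asbool.
- by exists 1%N => S; rewrite size_poly1.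
- exists (maxn n m) => S; apply: leq_trans (size_polyD _ _) _.
  by rewrite size_polyN geq_max !leq_max IHe IHd orbT.
- exists (n + m)%N => S; apply: leq_trans (size_polyMleq _ _) _.
  by apply: leq_trans (leq_pred _) _; apply: leq_add.
Qed.

Lemma poly_low_term (P : {poly K}) : P != 0 ->
  exists k (Q : {poly K}), [/\ P = 'X ^+ k * Q, Q.[0] != 0 & (k < size P)%N].
Proof.
move=> P0; have [k [Q]] := multiplicity_XsubC P 0.
rewrite P0 subr0 /= => Q0 PE; exists k, Q; split=> //; first by rewrite mulrC.
have nzQ : Q != 0 by apply: contra P0 => /eqP Q00; rewrite PE Q00 mul0r.
rewrite PE size_Mmonic ?monicXn // size_polyXn addnS /=.
by rewrite -[X in (X < _)%N]add0n ltn_add2r size_poly_gt0.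
Qed.

(** An element with limit [0] is divisible by [u], so its [m]-th power is divisible
    by [u ^ m]; this dominates the order of vanishing of [r], which is less than
    its number of coefficients in [u].  That [n] is chosen before [S] is what
    makes quotients of whole functions possible. *)
Lemma has_limit_expf_div (r s : pexpr I) : peval kvar r != 0 ->
    peval kvar s != 0 ->
  exists n, forall (S : set I) a m, has_limit S a 0 -> (n <= m)%N ->
    has_limit S (a ^+ m / (peval kvar r / peval kvar s)) 0.
Proof.
move=> r0 s0; have [n rn] := scaled_peval_size r.
exists n => S a m [e d k P Q -> eP dQ Q0 /esym/eqP].
rewrite mulf_eq0 invr_eq0 (negbTE Q0) orbF => /factor_theorem[P1].
rewrite subr0 => PE nm.
(* Setting [u = 1] undoes the scaling. *)
have sr0 : peval (scaled S kvar) r != 0.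
  apply: contra r0 => /eqP /(congr1 (horner_eval 1)).
  rewrite rmorph0 rmorph_peval => r1; apply/eqP; rewrite -[RHS]r1.
  apply: eq_peval => x.
  by rewrite /= /scaled /horner_eval hornerM hornerC hornerXn expr1n mulr1.
have [j [R [rR R0 jr]]] := poly_low_term sr0.
have jm : (j < m)%N by apply: leq_trans nm; apply: leq_trans jr (rn S).
apply: (@HasLimit _ _ _ (PMul (PPow e m) s) (PMul (PPow d m) r) (k * m + j)
          ('X ^+ (m - j) * P1 ^+ m * peval (scaled S kvar) s) (Q ^+ m * R)).
- by rewrite /= !peval_pow expr_div_n invf_div mulf_div.
- rewrite /= peval_pow eP PE !exprMn -exprM exprD !mulrA -(mulrA _ 'X^j) -exprD.
  by rewrite subnKC ?(ltnW jm) // [_ * P1 ^+ m * _]mulrAC.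
- by rewrite /= peval_pow dQ rR !exprMn -exprM exprD mulrACA.
- by rewrite hornerM horner_exp mulf_neq0 ?expf_neq0.
- by rewrite !hornerM hornerXn expr0n subn_eq0 leqNgt jm !mul0r.
Qed.

End Limits.

(** * Patch topology and hull-kernel topology *)

Section PatchTopology.
Variables (M : choiceType) (X : set (hull_kernel M)).

(** Closedness in the product topology of the power set: the basic neighbourhoods
    of [N] prescribe membership at finitely many elements. *)
Definition patch_closed : Prop := forall N : set M,
  (forall F : seq M, exists2 N', X N' & {in F, forall x, (N' : set M) x <-> N x}) ->
  X N.

Definition elts (N : X) : set M := val N.

Lemma elts_inj : injective elts.
Proof. by move=> N N' /val_inj. Qed.

Lemma near_all_seq (T : Type) (U : set_system T) (F : seq M) (P : M -> set T) :
  Filter U -> {in F, forall x, U (P x)} ->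
  U [set t | {in F, forall x, P x t}].
Proof.
move=> FU; elim: F => [|x F IH] UP; first by apply: filterS filterT.
have /IH UF : {in F, forall y, U (P y)}.
  by move=> y yF; apply: UP; rewrite inE yF orbT.
have Ux : U (P x) by apply: UP; rewrite mem_head.
by apply: filterS2 Ux UF => t Px PF y /predU1P[->|/PF].
Qed.

Definition patch_lim (U : set_system X) (L : X) : Prop :=
  forall x, U [set N | elts N x <-> elts L x].

Lemma patch_lim_near (U : set_system X) (L : X) (F : seq M) :
  Filter U -> patch_lim U L ->
  U [set N | {in F, forall x, elts N x <-> elts L x}].
Proof.
move=> FU UL.
exact: (near_all_seq (P := fun x => [set N | elts N x <-> elts L x])).
Qed.

(** Tychonoff for the power set: membership of [x] in the limit is decided by the
    ultrafilter, and the limit lies in [X] because [X] is patch-closed. *)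
Lemma patch_compact (U : set_system X) :
  patch_closed -> UltraFilter U -> exists L, patch_lim U L.
Proof.
move=> Xcl UU; have FU : ProperFilter U by apply: ultra_proper.
pose L := [set x | U [set N | elts N x]].
have UL x : U [set N | elts N x <-> L x].
  have [Ux|Ux] := in_ultra_setVsetC [set N | elts N x] UU.
    by apply: filterS (Ux) => N Nx; split.
  apply: filterS (Ux) => N Nx; split=> // Lx.
  by have /filter_ex[N1 []] : U (~` [set N | elts N x] `&` [set N | elts N x])
    by apply: filterI.
have XL : X L.
  apply: Xcl => F.
  have /filter_ex[N NF] : U [set N | {in F, forall x, elts N x <-> L x}].
    exact: (near_all_seq (P := fun x => [set N | elts N x <-> L x])).
  by exists (val N) => //; apply/set_mem/valP.
by exists (SigSub (mem_set XL)).
Qed.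

Lemma open_notin x : open [set N : X | ~ elts N x].
Proof.
exists [set R : hull_kernel M | ~ ([set x] `<=` R)].
  exists [set [set R : hull_kernel M | ~ ([set x] `<=` R)]].
    move=> _ ->; apply: (@finI_from1 _ _ finite_set
      (fun F : set M => [set R : hull_kernel M | ~ (F `<=` R)])).
    exact: finite_set1.
  exact: bigcup_set1.
by apply/seteqP; split=> N nN Nx; apply: nN; [move=> _ ->|exact: Nx].
Qed.

Lemma hull_nbhs (N : X) (A : set X) : nbhs N A ->
  exists F : seq M, {in F, forall x, ~ elts N x} /\
    forall N', {in F, forall x, ~ elts N' x} -> A N'.
Proof.
rewrite nbhsE => -[_ [[_ [D' sD' <-] <-] [B D'B BN]] sA].
have [E EB] : exists E : seq (set M),
    B = [set R | {in E, forall G, ~ (G `<=` R)}].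
  have [E _ <-] := sD' _ D'B; exists (finmap.enum_fset E).
  by apply/seteqP; split.
subst B.
have [F [FN EF]] : exists F : seq M, {in F, forall x, ~ elts N x} /\
    {in E, forall G : set M, exists2 x, x \in F & G x}.
  have : {in E, forall G, ~ (G `<=` elts N)} by [].
  elim: E {D'B BN} => [|G E IH] BN; first by exists [::].
  have /existsNP[x /not_implyP[Gx Nx]] := BN G (mem_head _ _).
  have [|F [FN EF]] := IH; first by move=> H HE; apply: BN; rewrite inE HE orbT.
  exists (x :: F); split=> [y /predU1P[->|/FN]//|H /predU1P[->|/EF[y yF Hy]]].
    by exists x; rewrite ?mem_head.
  by exists y; rewrite // inE yF orbT.
exists F; split=> // N' N'F; apply: sA; eexists; first exact: D'B.
by move=> G /EF[x xF Gx] sub; apply: (N'F x xF); apply: sub.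
Qed.

Lemma patch_lim_cvg (U : set_system X) L : Filter U -> patch_lim U L -> U --> L.
Proof.
move=> FU UL A /hull_nbhs[F [LF FA]].
have := patch_lim_near F FU UL.
by apply: filterS => N NF; apply: FA => x xF /(NF x xF); apply: LF.
Qed.

(** The hull-kernel open sets only test non-membership, so a hull-kernel limit can
    be larger than the patch limit but must contain it. *)
Lemma patch_lim_subset (U : set_system X) L N : ProperFilter U ->
  U --> N -> patch_lim U L -> elts L `<=` elts N.
Proof.
move=> FU UN UL x Lx.
apply: contrapT => Nx.
have UNx : U [set N' | ~ elts N' x].
  by apply: UN; apply: open_nbhs_nbhs; split=> //; apply: open_notin.
have /filter_ex[N' [N'x [_ /(_ Lx)//]]] :
  U ([set N' | ~ elts N' x] `&` [set N' | elts N' x <-> elts L x]).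
exact: filterI.
Qed.

End PatchTopology.

(** * The ring of compatible functions *)

Section Ring.
Local Open Scope ring_scope.
Variables (M : choiceType) (T : generic_family M) (X : set (hull_kernel M)).

Local Notation K := (gfield T).

Definition depends_on (F : seq M) (f : X -> K) : Prop :=
  forall N N', {in F, forall x, elts N x <-> elts N' x} -> f N = f N'.

(** Already for [N' = N] this is a condition: [f N] equals its own limit, as an
    element built from the indeterminates outside [N] does. *)
Definition specializes (f : X -> K) : Prop :=
  forall N N', elts N `<=` elts N' -> has_limit (elts N') (f N) (f N').

Lemma depends_on_op (op : K -> K -> K) F G f g : depends_on F f -> depends_on G g ->
  depends_on (F ++ G) (fun N => op (f N) (g N)).
Proof.
move=> fF gG N N' NN'; congr (op _ _).
  by apply: fF => x xF; apply: NN'; rewrite mem_cat xF.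
by apply: gG => x xG; apply: NN'; rewrite mem_cat xG orbT.
Qed.

Definition section_pred : {pred X -> K} :=
  fun f => `[< (exists F, depends_on F f) /\ specializes f >].

Lemma section_pred_subring : subring_closed section_pred.
Proof.
split.
- apply/asboolP; split; first by exists [::].
  by move=> N N' _; apply: has_limit1.
- move=> f g /asboolP[[F fF] fs] /asboolP[[G gG] gs]; apply/asboolP; split.
    by exists (F ++ G); apply: (depends_on_op (fun a b => a - b) fF gG).
  by move=> N N' NN'; apply: has_limitB; [apply: fs|apply: gs].
- move=> f g /asboolP[[F fF] fs] /asboolP[[G gG] gs]; apply/asboolP; split.
    by exists (F ++ G); apply: (depends_on_op *%R fF gG).
  by move=> N N' NN'; apply: has_limitM; [apply: fs|apply: gs].
Qed.

Record sections := Section_ { section_fun :> X -> K; _ : section_fun \in section_pred }.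

HB.instance Definition _ := [isSub for section_fun].
HB.instance Definition _ := [Choice of sections by <:].
HB.instance Definition _ :=
  GRing.SubChoice_isSubComPzRing.Build _ _ sections section_pred_subring.

Lemma section_depends (f : sections) : exists F, depends_on F f.
Proof. by have /asboolP[] := valP f. Qed.

Lemma section_specializes (f : sections) : specializes f.
Proof. by have /asboolP[] := valP f. Qed.

Lemma section_near (f : sections) (U : set_system X) L :
  Filter U -> patch_lim U L -> U [set N | f N = f L].
Proof.
move=> FU UL; have [F fF] := section_depends f.
by have := patch_lim_near F FU UL; apply: filterS => N /fF.
Qed.

Lemma section_exp (f : sections) n N : (f ^+ n) N = f N ^+ n.
Proof. by elim: n => [|n IH] //; rewrite !exprS -IH. Qed.

Lemma section_muln (f : sections) n N : (f *+ n) N = f N *+ n.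
Proof. by elim: n => [|n IH] //; rewrite !mulrS -IH. Qed.

Lemma coordinate_subproof x :
  (fun N : X => if `[< elts N x >] then 0 else gvar T x) \in section_pred.
Proof.
apply/asboolP; split.
  by exists [:: x] => N N' /(_ x (mem_head _ _)) NN'; rewrite (asbool_equiv_eq NN').
move=> N N' NN'; case: (asboolP (elts N' x)) => N'x.
  case: asboolP => Nx; first exact: has_limit0.
  exact: has_limit_var_in.
by rewrite asboolF; [apply: has_limit_var_notin|move=> /NN'].
Qed.

Definition coordinate x : sections := Section_ (coordinate_subproof x).

Lemma coordinate_eq0 x N : coordinate x N = 0 <-> elts N x.
Proof.
rewrite /coordinate /=; case: asboolP => // Nx.
by split=> // /eqP; rewrite (negbTE (gvar_neq0 T x)).
Qed.

(** A section is a function of the finite vector of truth values that describes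
    membership at the elements it depends on. *)
Lemma section_finite_range (f : sections) : finite_set (range f).
Proof.
have [F fF] := section_depends f.
pose profile (N : X) := [tuple `[< elts N (tnth (in_tuple F) i) >] | i < size F].
pose value b := xget 0 [set f N | N in [set N | profile N = b]].
apply: (@sub_finite_set _ _ (value @` [set: (size F).-tuple bool])); last first.
  exact/finite_image/finite_finset.
move=> _ [N _ <-]; exists (profile N) => //.
rewrite /value; case: xgetP => [_ -> [N' N'N <-]|/(_ (f N))[]]; last by exists N.
apply: fF => x /seq_tnthP[i ->].
have := congr1 (fun b => tnth b i) N'N; rewrite !tnth_mktuple => N'Ni.
exact: asbool_eq_equiv.
Qed.

(** The quotient of a power of [g] by [f], read as [0] where [f] vanishes, has the
    right limits: the only case that is not formal is [f N != 0] and [f N' = 0],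
    where [g N] has limit [0] and a large power of it absorbs [f N].  One exponent
    serves all [N], as [f] has finite range. *)
Lemma zero_locus_subset (f g : sections) :
  (forall N, f N = 0 -> g N = 0) -> exists n (q : sections), g ^+ n = f * q.
Proof.
move=> fg.
(* An element without any limit is not a value of [f], and its bound is arbitrary. *)
have bound (c : K) : exists n, forall S0 b, has_limit S0 c b -> c != 0 ->
    forall (S : set M) a m, has_limit S a 0 -> (n <= m)%N -> has_limit S (a ^+ m / c) 0.
  have [[S0 [b [e d k P Q ce eP dQ Q0 _]]]|nc] :=
      pselect (exists S0 b, has_limit S0 c b); last first.
    by exists 0%N => S0 b Sb; case: nc; exists S0, b.
  have [c0|c0] := eqVneq c 0; first by exists 0%N.
  move: c0; rewrite {1}ce mulf_eq0 invr_eq0 negb_or => /andP[e0 d0].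
  by have [n nP] := has_limit_expf_div e0 d0; exists n => _ _ _ _; rewrite ce.
have [b bP] := choice bound.
have /finite_seqP[s fs] := section_finite_range f.
(* The successor keeps [n] positive, so that [g ^+ n] vanishes where [g] does. *)
pose n := (\max_(c <- s) b c).+1.
have bn N : (b (f N) <= n)%N.
  have fNs : f N \in s by have : range f (f N) by []; rewrite fs.
  by apply: leqW; apply: leq_bigmax_seq.
have q_in : (fun N => g N ^+ n / f N) \in section_pred.
  have [F fF] := section_depends f; have [G gG] := section_depends g.
  apply/asboolP; split.
    by exists (F ++ G); apply: (depends_on_op (fun a b => b ^+ n / a) fF gG).
  move=> N N' NN'.
  have flim := section_specializes f NN'; have glim := section_specializes g NN'.
  have [fN'|fN'] := eqVneq (f N') 0; last first.
    by apply: has_limitM; [apply: has_limitX|apply: has_limitV].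
  rewrite fN' invr0 mulr0.
  have [->|fN] := eqVneq (f N) 0; first by rewrite invr0 mulr0; apply: has_limit0.
  apply: (bP _ _ _ flim fN) (bn N).
  by rewrite -[0](fg N' fN').
exists n, (Section_ q_in); apply: val_inj; apply: funext => N.
rewrite -[LHS]/((g ^+ n) N) section_exp.
rewrite -[RHS]/(f N * (g N ^+ n / f N)).
have [fN|fN] := eqVneq (f N) 0; first by rewrite fN (fg N fN) mul0r expr0n.
by rewrite mulrCA divff // mulr1.
Qed.

(** It suffices that [n] avoid the values of [- f / g], which are finite in
    number. *)
Lemma zero_locus_add (f g : sections) :
  exists n, forall N, (f + g *+ n) N = 0 -> f N = 0 /\ g N = 0.
Proof.
pose A := [set - f N / g N | N in setT].
have Afin : finite_set A.
  have : finite_set ((fun p : K * K => - p.1 / p.2) @` (range f `*` range g)).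
    by apply: finite_image; apply: finite_setX; apply: section_finite_range.
  by apply: sub_finite_set => _ [N _ <-]; exists (f N, g N) => //; split; exists N.
have [n nA] : exists n : nat, ~ A n%:R.
  apply: contrapT => all_in; apply: infinite_nat.
  have -> : [set: nat] = (fun n => n%:R : K) @^-1` A.
    apply/seteqP; split=> // n _; apply: contrapT => nn; apply: all_in.
    by exists n.
  by apply: finite_preimage => // m n _ _; apply: gfield_natr_inj.
exists n => N; rewrite -[LHS]/(f N + (g *+ n) N) section_muln => fgN.
suff gN : g N = 0 by move: fgN; rewrite gN mul0rn addr0.
apply: contrapT => /eqP gN; apply: nA; exists N => //.
move/eqP: fgN; rewrite addr_eq0 => /eqP ->.
by rewrite opprK -[g N *+ n]mulr_natl mulfK.
Qed.

Lemma zero_ideal_prime N : prime_ideal [set f : sections | f N = 0].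
Proof.
split=> /=.
- by [].
- by move=> f g fN gN; rewrite -[LHS]/(f N + g N) fN gN addr0.
- by move=> f g gN; rewrite -[LHS]/(f N * g N) gN mulr0.
- by move/eqP; rewrite -[X in X == _]/(1 : K) oner_eq0.
- move=> f g /eqP; rewrite -[X in X == _]/(f N * g N) mulf_eq0.
  by case/orP=> /eqP; [left|right].
Qed.

Definition zero_ideal (N : X) : Spec sections := exist _ _ (zero_ideal_prime N).

Lemma zero_ideal_inj : injective zero_ideal.
Proof.
move=> N N' /(congr1 sval) /= NN'; apply: elts_inj; apply/seteqP.
have {}NN' (f : sections) : f N = 0 <-> f N' = 0.
  by have := congr1 (@^~ f) NN' => /= ->.
by split=> x Nx; apply/coordinate_eq0/NN'/coordinate_eq0.
Qed.

Hypothesis Xclosed : patch_closed X.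

(** If [f] had zeros arbitrarily close to [N], an ultrafilter of such zeros that
    converges to [N] would have a patch limit [L] with [f L = 0] and [L] contained
    in [N]; but a nonzero limit [f N] forces [f L] to be nonzero. *)
Lemma open_nonzero (f : sections) : open [set N | f N != 0].
Proof.
rewrite openE => N /= fN; apply: contrapT => Nint.
pose G := within [set N | f N = 0] (nbhs N).
have GF : ProperFilter G.
  apply: Build_ProperFilter_ex => A GA; apply: contrapT => A0; apply: Nint.
  have NA : nbhs N [set N' | f N' = 0 -> A N'] := GA.
  apply: (filterS _ NA) => N' /= N'A; apply/eqP => fN'; apply: A0; exists N'.
  exact: N'A.
have [U [UU GU]] := ultraFilterLemma GF.
have UN : U --> N.
  by move=> A NA; apply: GU; rewrite /G /within; apply: (filterS _ (NA : nbhs N A)).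
have [L UL] := patch_compact Xclosed UU.
have Uf : U [set N | f N = 0] by apply: GU; apply: withinT.
have PU : ProperFilter U by apply: ultra_proper.
have LN := patch_lim_subset PU UN UL.
have /negP := has_limit_neq0 (section_specializes f LN) fN.
apply; apply/eqP.
have /filter_ex[N' [/= N'0 <-//]] : U ([set N | f N = 0] `&` [set N | f N = f L]).
by apply: filterI => //; apply: section_near.
Qed.

Lemma prime_ideal_exp (R : comPzRingType) (P : set R) (a : R) n :
  prime_ideal P -> P (a ^+ n) -> P a.
Proof.
move=> Pp; elim: n => [/(prime_ideal1 Pp)//|n IH]; rewrite exprS.
by case/(prime_idealM Pp).
Qed.

(** The sets where a member [f] of the prime vanishes and a non-member [g] does not
    are nonempty by [zero_locus_subset] and directed by [zero_locus_add]; a patch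
    limit along them vanishes exactly under the members of the prime. *)
Lemma zero_ideal_surj (P : Spec sections) : exists N, zero_ideal N = P.
Proof.
case: P => P Pp.
pose W (fg : sections * sections) := [set N : X | fg.1 N = 0 /\ fg.2 N != 0].
pose D := [set fg : sections * sections | P fg.1 /\ ~ P fg.2].
have WF : ProperFilter (filter_from D W).
  apply: filter_from_proper; last first.
    move=> [f g] /= [Pf Pg]; apply: contrapT => W0; apply: Pg.
    have [N fN|n [q gq]] := @zero_locus_subset f g.
      by apply: contrapT => /eqP gN; apply: W0; exists N.
    apply: (prime_ideal_exp (n := n) Pp); rewrite gq mulrC.
    exact: prime_idealMl.
  apply: filter_from_filter.
    by exists (0, 1) => //; split; [apply: prime_ideal0|apply: prime_ideal1].
  move=> [f g] [f' g'] [/= Pf Pg] [/= Pf' Pg'].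
  have [n fn] := zero_locus_add f f'.
  exists (f + f' *+ n, g * g').
    split=> /=; last by case/(prime_idealM Pp).
    apply: prime_idealD => //; rewrite -mulr_natl; exact: prime_idealMl.
  move=> N /= [/fn[fN f'N]]; rewrite -[X in X != _]/(g N * g' N) mulf_eq0 negb_or.
  by case/andP.
have [U [UU WU]] := ultraFilterLemma WF.
have PU : ProperFilter U by apply: ultra_proper.
have [L UL] := patch_compact Xclosed UU.
have value (f : sections) (A : set X) :
    U A -> (forall N, f N = f L -> A N -> A L) -> A L.
  move=> UA AL; have /filter_ex[N [NA /AL]] : U (A `&` [set N | f N = f L]).
    by apply: filterI => //; apply: section_near.
  exact.
exists L; apply: eq_exist => /=; apply/seteqP; split=> f.
  move=> /= fL; apply: contrapT => Pf.
  have : [set N | f N != 0] L; last by rewrite /= fL eqxx.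
  apply: (value f) => [|N /= ->//]; apply: WU; exists (0, f); last by move=> N [].
  by split=> //; apply: prime_ideal0.
move=> Pf; apply: (value f [set N | f N = 0]) => [|N /= ->//].
apply: WU; exists (f, 1); last by move=> N [].
by split=> //; apply: prime_ideal1.
Qed.

(** Continuity of the inverse is the identity [coordinate_eq0]: the complement of
    the zero set of [coordinate x] corresponds to the points that avoid [x]. *)
Lemma patch_closed_spectral : spectral X.
Proof.
exists sections; have [g gK] := choice zero_ideal_surj.
exists zero_ideal, g; split=> //.
- by move=> N; apply: zero_ideal_inj; rewrite gK.
- apply/continuousP => _ [E ->].
  rewrite (_ : _ @^-1` _ = \bigcup_(f in E) [set N | f N != 0]).
    by apply: bigcup_open => f _; apply: open_nonzero.
  apply/seteqP; split=> N /=.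
    by move=> /existsNP[f /not_implyP[Ef /eqP fN]]; exists f.
  by move=> [f Ef /eqP fN] /(_ f Ef).
- move=> P A /hull_nbhs[F [FP FA]].
  have coordinateP P' x : sval P' (coordinate x) <-> elts (g P') x.
    by rewrite -{1}(gK P'); apply: coordinate_eq0.
  have : nbhs P [set P' | {in F, forall x, ~ elts (g P') x}].
    apply: (near_all_seq (P := fun x => [set P' | ~ elts (g P') x])) => x xF.
    apply: open_nbhs_nbhs; split; last exact: FP.
    exists [set coordinate x]; apply/seteqP; split=> P' /= gx sub; apply: gx.
      by apply/coordinateP/sub.
    by move=> _ ->; apply/coordinateP.
  by apply: filterS => P' /FA.
Qed.

End Ring.

(** * Spaces of A-subsets *)

Section SSet.
Variables (A : pmonoidType) (M : asetType A).

Lemma SSet_patch_closed : patch_closed (SSet M).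
Proof.
move=> N FN; split.
  have [N' [N'0 _] N'N] := FN [:: point].
  exact/(N'N point (mem_head _ _)).
move=> a y Ny; have [N' [_ N'act] N'N] := FN [:: y; act a y].
apply/(N'N (act a y)); first by rewrite !inE eqxx orbT.
by apply: N'act; apply/(N'N y); first rewrite mem_head.
Qed.

Lemma DSSetE (xs : seq M) :
  DSSet xs = [set N | exists2 x, x \in xs & ~ elts N x].
Proof.
apply/seteqP; split=> N.
  by move=> /existsNP[x /not_implyP[xs_x Nx]]; exists x.
by move=> [x xs_x Nx] sub; apply: Nx; apply: sub.
Qed.

Lemma DSSet_open (xs : seq M) : open (DSSet xs).
Proof.
rewrite DSSetE (_ : [set _ | _] = \bigcup_(x in [set` xs]) [set N | ~ elts N x]).
  by apply: bigcup_open => x _; apply: open_notin.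
by apply/seteqP; split=> N [x xs_x Nx]; exists x.
Qed.

(** An ultrafilter containing [DSSet xs] has a patch limit, which avoids the same
    elements of [xs] as almost every member, and to which it converges also in the
    coarser hull-kernel topology. *)
Lemma DSSet_compact (xs : seq M) : compact (DSSet xs).
Proof.
rewrite compact_ultra => U UU Uxs.
have PU : ProperFilter U by apply: ultra_proper.
have [L UL] := patch_compact SSet_patch_closed UU.
exists L; split; last exact: patch_lim_cvg.
rewrite DSSetE /= in Uxs *.
have /filter_ex[N [[x xs_x Nx] NL]] :
    U ([set N | exists2 x, x \in xs & ~ elts N x] `&`
       [set N | {in xs, forall x, elts N x <-> elts L x}]).
  by apply: filterI => //; apply: patch_lim_near.
by exists x => // /(NL x xs_x).
Qed.

Lemma DSSet_subbasis : subbasis (range (@DSSet A M)).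
Proof.
split.
  move=> _ [E sE <-]; rewrite bigcap_fset.
  rewrite big_seq; elim/big_ind: _; [exact: openT|exact: openI|].
  by move=> B /sE; rewrite inE => -[xs _ <-]; apply: DSSet_open.
move=> N U /hull_nbhs[F [NF FU]].
have [B [FB BN BF]] : exists B, [/\ finI_from (range (@DSSet A M)) id B, B N &
    B `<=` [set N' | {in F, forall x, ~ elts N' x}]].
  elim: F NF {FU} => [|x F IH] NF.
    by exists setT; split=> //; exists finmap.fset0 => //; rewrite set_fset0 bigcap_set0.
  have [|B [FB BN BF]] := IH; first by move=> y yF; apply: NF; rewrite inE yF orbT.
  exists (DSSet [:: x] `&` B); split.
  - by apply: finI_fromI => //; apply: (@finI_from1 _ _ _ id); exists [:: x].
  - split=> //; rewrite DSSetE; exists x; rewrite ?mem_head //.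
    by apply: NF; rewrite mem_head.
  - move=> N'; rewrite DSSetE => -[[z + N'z] BN'] y; rewrite inE => /eqP zx.
    by rewrite inE => /predU1P[->|/(BF _ BN')//]; rewrite -zx.
by exists B => // N' /BF /FU.
Qed.

End SSet.

Theorem proposition3p2 (A : pmonoidType) (M : asetType A) :
  [/\ spectral (SSet M),
      subbasis (range (@DSSet A M)) &
      forall xs : seq M, open (DSSet xs) /\ compact (DSSet xs)].
Proof.
split.
- exact: (@patch_closed_spectral M (zpoly_family M) _ (@SSet_patch_closed A M)).
- exact: DSSet_subbasis.
- by move=> xs; split; [apply: DSSet_open|apply: DSSet_compact].
Qed.
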